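(* The Lie algebra $\mathbf g=\mathfrak{sl}_3(\mathbb R)$ is reductive with respect to a pair $(\mathbf h,\mathbf m)$, where $\mathbf h$ is a $2$-dimensional subalgebra of $\mathbf g$ and $\mathbf m$ is a complementary subspace to $\mathbf h$ generating $\mathbf g$, up to conjugation, in exactly one of the following cases: 1) $\mathbf h_{26}=\langle e_5,e_8\rangle$ and $\mathbf m_{26}=\langle e_1,e_2,e_3,e_4,e_6,e_7\rangle$; 2) $\mathbf h_{30}=\langle e_5+e_8,e_6-e_7\rangle$ and $\mathbf m_{30}=\langle e_1,e_2,e_3,e_4,e_5-e_8,e_6+e_7\rangle$.
   Context: $\mathbf g=\mathfrak{sl}_3(\mathbb R)$ has the basis $e_1,\dots,e_8$ determined by $$\sum_{i=1}^8\lambda_i e_i=\begin{pmatrix}-\lambda_5-\lambda_8&\lambda_1&\lambda_2\\ \lambda_3&\lambda_5&\lambda_6\\ \lambda_4&\lambda_7&\lambda_8\end{pmatrix},\qquad\lambda_i\in\mathbb R.$$ $\langle\cdots\rangle$ denotes the real linear span. $\mathbf g$ is reductive with respect to $(\mathbf h,\mathbf m)$ if $\mathbf h$ is a subalgebra, $\mathbf m$ is a subspace, $\mathbf g=\mathbf m\oplus\mathbf h$ and $[\mathbf h,\mathbf m]\subseteq\mathbf m$. ''$\mathbf m$ generates $\mathbf g$'' means generation as a Lie algebra. ''Up to conjugation'' means that the pair $(\mathbf h,\mathbf m)$ may be replaced by its image under $Ad_g$, $g\in SL_3(\mathbb R)$. *)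

(* Defs.v *)
From HB Require Import structures.
From mathcomp Require Import all_boot all_order all_algebra.
From mathcomp Require Import reals.

Set Implicit Arguments.
Unset Strict Implicit.
Unset Printing Implicit Defensive.

Import GRing.Theory.
Local Open Scope ring_scope.

Section LieMatrix.
Variables (K : fieldType) (n : nat).
Implicit Types (x y a : 'M[K]_n) (g h m : {vspace 'M[K]_n}).

Definition lie x y : 'M[K]_n := x *m y - y *m x.

Definition sl : {vspace 'M[K]_n} :=
  lker (linfun (mxtrace : 'M[K]_n -> K^o)).

Lemma memv_sl x : (x \in sl) = (\tr x == 0).
Proof. by rewrite memv_ker lfunE. Qed.

Definition lie_subalgebra g h : Prop :=
  (h <= g)%VS /\ forall x y, x \in h -> y \in h -> lie x y \in h.

Definition reductive_pair g h m : Prop :=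
  [/\ lie_subalgebra g h,
      (m + h)%VS = g,
      directv (m + h)
    & forall x y, x \in h -> y \in m -> lie x y \in m].

(* The Lie subalgebra generated by [m] is the intersection of the Lie
   subalgebras of [g] containing [m]. *)
Definition lie_generates g m : Prop :=
  (m <= g)%VS /\ forall k, lie_subalgebra g k -> (m <= k)%VS -> k = g.

Definition Ad a x : 'M[K]_n := a *m x *m invmx a.

Fact Ad_is_linear a : linear (Ad a).
Proof.
by move=> c x y; rewrite /Ad mulmxDr mulmxDl -scalemxAr -scalemxAl.
Qed.

HB.instance Definition _ a :=
  GRing.isLinear.Build K 'M[K]_n 'M[K]_n _ (Ad a) (Ad_is_linear a).

Definition SL_conjugate h m h' m' : Prop :=
  exists a, [/\ \det a = 1,
                (linfun (Ad a) @: h)%VS = h' & (linfun (Ad a) @: m)%VS = m'].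

End LieMatrix.

Section SL3.
Variable R : realType.

(* The coordinates are indexed from 1 to 8; other values of [l] are unused. *)
Definition sl3_mx (l : nat -> R) : 'M[R]_3 :=
  \matrix_(i, j) nth 0 (nth [::]
    [:: [:: - l 5 - l 8; l 1; l 2];
        [:: l 3;         l 5; l 6];
        [:: l 4;         l 7; l 8]] i) j.

Definition e (k : nat) : 'M[R]_3 := sl3_mx (fun i => (i == k)%:R).

Lemma sum_e (l : nat -> R) : \sum_(1 <= i < 9) l i *: e i = sl3_mx l.
Proof.
rewrite unlock /=; apply/matrixP => -[[|[|[|//]]] ?] -[[|[|[|//]]] ?];
  by rewrite !mxE /= ?(mulr0, mulr1, addr0, add0r, subr0, sub0r, mulrN, mulN1r,
    oppr0).
Qed.

Lemma sl3_mxP x : x \in sl R 3 -> exists l, x = sl3_mx l.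
Proof.
rewrite memv_sl /mxtrace !big_ord_recl big_ord0 addr0 addr_eq0 => /eqP x00.
pose y i j : R := x (inord i) (inord j).
have yE (p q : 'I_3) : x p q = y p q by rewrite /y !inord_val.
exists (nth 0%R [:: 0%R; y 0 1; y 0 2; y 1 0; y 2 0; y 1 1; y 1 2;
                  y 2 1; y 2 2]%N).
move: x00; rewrite !yE /= => x00.
apply/matrixP => i j; rewrite mxE yE.
case: i j => [[|[|[|//]]] ?] [[|[|[|//]]] ?] //=.
by rewrite x00 opprD.
Qed.

Lemma e_basis : basis_of (sl R 3) [seq e i | i <- iota 1 8].
Proof.
have e_nth (i : 'I_8) : [seq e i | i <- iota 1 8]`_i = e i.+1.
  by rewrite (nth_map 0%N) ?size_iota // nth_iota.
apply/andP; split.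
  rewrite eqEsubv; apply/andP; split.
    apply/span_subvP => _ /mapP[i _ ->]; rewrite memv_sl /mxtrace.
    rewrite !big_ord_recl big_ord0 !mxE /=.
    by rewrite addr0 -opprD [X in - X]addrC addrC [X in X + _]addrC subrr.
  apply/subvP => x /sl3_mxP[l ->]; rewrite -sum_e big_seq rpred_sum // => i.
  rewrite mem_index_iota => i8; apply/memvZ/memv_span/map_f.
  by rewrite mem_iota.
apply/(@freeP _ _ 8 (in_tuple [seq e i | i <- iota 1 8])) => k /= k0.
pose l i := if i is j.+1 then k (inord j) else 0.
have : sl3_mx l = 0.
  rewrite -sum_e big_add1 big_mkord -{}[RHS]k0.
  by apply: eq_bigr => i _; rewrite e_nth /= inord_val.
move/matrixP => l0 i; rewrite -[i]inord_val -[k _]/(l i.+1).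
have := (l0 0 1, l0 0 (inord 2), l0 1 0, l0 (inord 2) 0, l0 1 1,
  l0 1 (inord 2), l0 (inord 2) 1, l0 (inord 2) (inord 2)).
rewrite !mxE !inordK //= => H.
by case: i => [[|[|[|[|[|[|[|[|//]]]]]]]] ?]; rewrite [nat_of_ord _]/= H.
Qed.

Definition h26 : {vspace 'M[R]_3} := span [:: e 5; e 8].
Definition m26 : {vspace 'M[R]_3} := span [:: e 1; e 2; e 3; e 4; e 6; e 7].

Definition h30 : {vspace 'M[R]_3} := span [:: e 5 + e 8; e 6 - e 7].
Definition m30 : {vspace 'M[R]_3} :=
  span [:: e 1; e 2; e 3; e 4; e 5 - e 8; e 6 + e 7].

End SL3.

(* Main.v *)
Require Import Defs.
From mathcomp Require Import all_boot all_order all_algebra.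
From mathcomp Require Import reals.
From mathcomp Require Import ring lra.

(** Let h be a reductive subalgebra of dimension 2 in sl_3, with complement m.

    No nonzero c in h with (ad c)^2 vanishing on h is nilpotent
    ([reductive_nilpotent_eq0]): for nilpotent c, Jacobson-Morozov gives z with
    [c, [c, z]] = c; splitting z along m + h, only the part in m contributes, so
    that c lies in m as well as in h.  If h were not abelian, its derived
    algebra would be a line spanned by an eigenvector c of some ad z with
    nonzero eigenvalue, and such a c is nilpotent; hence h is abelian
    ([reductive_dim2_abelian]) and without nonzero nilpotent elements.

    The determinant is an odd function on h, a real vector space of dimension
    2, so it vanishes at some x != 0 in h ([exists_singular]).  As x is
    traceless and singular, Cayley-Hamilton reads x^3 = (tr (x^2) / 2) x, where
    tr (x^2) != 0 because x is not nilpotent.  Rescaled so that x^3 = x or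
    x^3 = - x, x is conjugate to diag(0, -1, 1) = e8 - e5 in the first case
    ([similar_split]) and to the rotation generator e6 - e7 in the second one
    ([similar_rot]).  Both normal forms commute with diag(t, 1, 1), which
    corrects the determinant of the conjugating matrix ([conj_det1]).

    Each normal form d determines the pair: h is abelian of dimension 2, hence
    it is the centralizer of d, namely h26 or h30; and m contains the image of
    ad d, since ad d maps m to itself and kills h, and that image is m26 or m30
    ([reductive_eq26], [reductive_eq30]).

    Conversely the two pairs are reductive, and e1, ..., e4, which lie in both
    complements, generate sl_3 ([lie_generates_e1234]); these properties are
    invariant under conjugation.  The two cases exclude each other because
    tr (x^2) >= 0 on h26, whereas tr (x^2) = -2 at x = e6 - e7. *)

Set Implicit Arguments.
Unset Strict Implicit.
Unset Printing Implicit Defensive.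

Import Order.TTheory GRing.Theory Num.Theory.
Local Open Scope ring_scope.

(** * The bracket and the adjoint action *)

Section LieTheory.
Variables (K : fieldType) (n : nat).
Implicit Types (x y z a : 'M[K]_n) (g h m k : {vspace 'M[K]_n}).

Lemma lieDr x y z : lie x (y + z) = lie x y + lie x z.
Proof. by rewrite /lie mulmxDr mulmxDl opprD addrACA. Qed.

Lemma lieDl x y z : lie (x + y) z = lie x z + lie y z.
Proof. by rewrite /lie mulmxDr mulmxDl opprD addrACA. Qed.

Lemma lieZr c x y : lie x (c *: y) = c *: lie x y.
Proof. by rewrite /lie -scalemxAr -scalemxAl scalerBr. Qed.

Lemma lieZl c x y : lie (c *: x) y = c *: lie x y.
Proof. by rewrite /lie -scalemxAr -scalemxAl scalerBr. Qed.

Lemma liexx x : lie x x = 0. Proof. exact: subrr. Qed.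

Lemma lieC x y : lie x y = - lie y x. Proof. by rewrite /lie opprB. Qed.

Lemma lie_lie x y :
  lie x (lie x y) = x *m x *m y - (x *m y *m x) *+ 2 + y *m x *m x.
Proof.
rewrite /lie mulmxBr mulmxBl !mulmxA opprB mulr2n opprD !addrA.
by rewrite -[RHS]addrA [- _ + _]addrC addrA.
Qed.

Lemma lie_scalar x c : lie x c%:M = 0.
Proof. by rewrite /lie scalar_mxC subrr. Qed.

Lemma mxtrace_lie_mul x y : \tr (lie x y *m y) = 0.
Proof.
by rewrite /lie mulmxBl linearB /= -[y *m x *m y]mulmxA mxtrace_mulC subrr.
Qed.

Lemma mxtrace_lie_mul2 x y : \tr (lie x y *m (y *m y)) = 0.
Proof.
rewrite /lie mulmxBl linearB /= -[y *m x *m _]mulmxA [\tr (y *m _)]mxtrace_mulC.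
by rewrite !mulmxA subrr.
Qed.

(** Stated for invertible [a] of any determinant, so that a conjugating matrix
    may be found first and normalized to determinant 1 afterwards. *)
Lemma lie_Ad a x y :
  a \in unitmx -> lie (Ad a x) (Ad a y) = Ad a (lie x y).
Proof.
move=> ua; rewrite /lie linearB /= /Ad; congr (_ - _);
  by rewrite !mulmxA mulmxKV.
Qed.

Lemma AdK a : a \in unitmx -> cancel (Ad a) (Ad (invmx a)).
Proof. by move=> ua x; rewrite /Ad invmxK !mulmxA mulVmx // mul1mx mulmxKV. Qed.

Lemma AdKV a : a \in unitmx -> cancel (Ad (invmx a)) (Ad a).
Proof. by move=> ua x; rewrite /Ad invmxK !mulmxA mulmxV // mul1mx mulmxK. Qed.

Lemma mxtrace_Ad a x : a \in unitmx -> \tr (Ad a x) = \tr x.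
Proof. by move=> ua; rewrite mxtrace_mulC mulmxA mulVmx // mul1mx. Qed.

Lemma Ad_mul a x y : a \in unitmx -> Ad a x *m Ad a y = Ad a (x *m y).
Proof. by move=> ua; rewrite /Ad !mulmxA mulmxKV. Qed.

Lemma AdM a b x :
  a \in unitmx -> b \in unitmx -> Ad (a *m b) x = Ad a (Ad b x).
Proof.
move=> ua ub; rewrite /Ad !mulmxA -[_ *m invmx b *m _]mulmxA; congr (_ *m _).
have uab : a *m b \in unitmx by rewrite unitmx_mul ua.
by apply: (can_inj (mulKmx uab)); rewrite mulmxV // -mulmxA mulKVmx // mulmxV.
Qed.

Lemma memv_Ad_img a h x :
  a \in unitmx -> (x \in linfun (Ad a) @: h)%VS = (Ad (invmx a) x \in h).
Proof.
move=> ua; apply/memv_imgP/idP => [[y hy ->]|hx].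
  by rewrite lfunE /= AdK.
by exists (Ad (invmx a) x) => //; rewrite lfunE /= AdKV.
Qed.

Lemma Ad_img_KV a h h' : a \in unitmx ->
  (linfun (Ad a) @: h)%VS = h' <-> (linfun (Ad (invmx a)) @: h')%VS = h.
Proof.
move=> ua; have ua' : invmx a \in unitmx by rewrite unitmx_inv.
split=> <-; apply/vspaceP=> x; rewrite !memv_Ad_img ?invmxK //.
  by rewrite AdK.
by rewrite AdKV.
Qed.

Lemma Ad_img_sl a : a \in unitmx -> (linfun (Ad a) @: sl K n)%VS = sl K n.
Proof.
move=> ua; apply/vspaceP=> x.
by rewrite memv_Ad_img // !memv_sl mxtrace_Ad // unitmx_inv.
Qed.

Lemma lker0_Ad a : a \in unitmx -> lker (linfun (Ad a)) == 0%VS.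
Proof.
by move=> ua; apply/lker0P=> x y; rewrite !lfunE; apply: (can_inj (AdK ua)).
Qed.

Lemma lie_subalgebra_Ad a h : a \in unitmx ->
  lie_subalgebra (sl K n) h -> lie_subalgebra (sl K n) (linfun (Ad a) @: h).
Proof.
move=> ua [hg hh]; split=> [|x y]; first by rewrite -(Ad_img_sl ua) limgS.
have ua' : invmx a \in unitmx by rewrite unitmx_inv.
by rewrite !memv_Ad_img // -lie_Ad //; apply: hh.
Qed.

Lemma reductive_pair_Ad a h m : a \in unitmx ->
  reductive_pair (sl K n) h m ->
  reductive_pair (sl K n) (linfun (Ad a) @: h) (linfun (Ad a) @: m).
Proof.
move=> ua [sh eg /directv_addP dmh hm]; split.
- exact: lie_subalgebra_Ad.
- by rewrite -limgD eg Ad_img_sl.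
- by apply/directv_addP; rewrite -lker0_img_cap ?lker0_Ad // dmh limg0.
have ua' : invmx a \in unitmx by rewrite unitmx_inv.
by move=> x y; rewrite !memv_Ad_img // -lie_Ad //; apply: hm.
Qed.

Lemma dim_Ad a h : a \in unitmx -> \dim (linfun (Ad a) @: h) = \dim h.
Proof.
move=> ua; apply: limg_dim_eq.
by have /eqP-> := lker0_Ad ua; rewrite capv0.
Qed.

Lemma lie_generates_Ad a m : a \in unitmx ->
  lie_generates (sl K n) m -> lie_generates (sl K n) (linfun (Ad a) @: m).
Proof.
move=> ua [mg gen]; split=> [|k sk mk]; first by rewrite -(Ad_img_sl ua) limgS.
have ua' : invmx a \in unitmx by rewrite unitmx_inv.
rewrite -[RHS](Ad_img_sl ua); apply/esym/(Ad_img_KV _ _ ua)/gen.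
  exact: lie_subalgebra_Ad.
rewrite -((Ad_img_KV m _ ua).1 erefl); exact: limgS.
Qed.

(** By [h]-invariance of the splitting, [ad c ^ 2] sees only the component of
    [z] along [m], and keeps it in [m]: so [c] belongs to [m] and to [h]. *)
Lemma reductive_ad2_eq0 g h m c z : reductive_pair g h m ->
  c \in h -> z \in g -> lie c (lie c z) = c ->
  (forall w, w \in h -> lie c (lie c w) = 0) -> c = 0.
Proof.
move=> [_ <- /directv_addP dmh hm] hc /memv_addP[a ma [b hb ->]].
move=> ccz cch; have cm : lie c (lie c (a + b)) \in m.
  by rewrite (lieDr c a) (lieDr c (lie c a)) (cch b) // addr0 !hm.
by apply/eqP; rewrite -memv0 -dmh memv_cap hc andbT -[X in X \in _]ccz.
Qed.

(** The hypothesis on [r] says that [y] is the matrix of right multiplication by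
    [x] in the basis [r] of row vectors. *)
Lemma similar_of_rows x y (r : 'I_n -> 'rV[K]_n) :
    (forall i, r i *m x = \sum_j y i j *: r j) ->
    (forall c : 'rV_n, \sum_j c 0 j *: r j = 0 -> c = 0) ->
  exists2 a, a \in unitmx & Ad a x = y.
Proof.
move=> rx r_free; pose a := \matrix_i r i.
have ua : a \in unitmx.
  rewrite unitmxE unitfE; apply/negP => /det0P[c c0 /eqP].
  rewrite mulmx_sum_row => /eqP ca; case/eqP: c0; apply: r_free.
  by rewrite -[RHS]ca; apply: eq_bigr => j _; rewrite rowK.
exists a => //; rewrite /Ad; apply: (canLR (mulmxK ua)).
apply/row_matrixP => i; rewrite !row_mul rowK rx mulmx_sum_row.
by apply: eq_bigr => j _; rewrite rowK mxE.
Qed.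

End LieTheory.

(** * Cayley-Hamilton and Jacobson-Morozov in size three *)

Local Notation i0 := (@Ordinal 3 0 isT).
Local Notation i1 := (@Ordinal 3 1 isT).
Local Notation i2 := (@Ordinal 3 2 isT).

Lemma forall_I3 (P : 'I_3 -> Prop) : P i0 -> P i1 -> P i2 -> forall i, P i.
Proof.
by move=> P0 P1 P2 [[|[|[|//]]] i3]; [move: P0|move: P1|move: P2];
  congr P; apply: val_inj.
Qed.

Lemma sum_I3 (V : nmodType) (F : 'I_3 -> V) : \sum_i F i = F i0 + F i1 + F i2.
Proof.
rewrite !big_ord_recl big_ord0 addr0 addrA.
by congr (F _ + F _ + F _); apply: val_inj.
Qed.

Ltac entrywise := apply/matrixP; apply: forall_I3; apply: forall_I3;
  rewrite !(mxE, sum_I3) /=.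

Lemma det3 (K : comNzRingType) (x : 'M[K]_3) :
  \det x = x i0 i0 * (x i1 i1 * x i2 i2 - x i1 i2 * x i2 i1)
         - x i0 i1 * (x i1 i0 * x i2 i2 - x i1 i2 * x i2 i0)
         + x i0 i2 * (x i1 i0 * x i2 i1 - x i1 i1 * x i2 i0).
Proof.
pose y i j := x (inord i) (inord j).
have yE p q : x p q = y p q by rewrite /y !inord_val.
rewrite (expand_det_row _ ord0) !big_ord_recl big_ord0 /cofactor.
rewrite !(expand_det_row _ ord0) !big_ord_recl !big_ord0 /cofactor !det_mx11.
rewrite !mxE !yE /=.
ring.
Qed.

Section Traceless.
Variable K : numFieldType.
Implicit Types (c x y z : 'M[K]_3).

(** The coefficient of the linear term of the characteristic polynomial is
    [(tr x ^ 2 - tr (x ^ 2)) / 2], here [- tr (x ^ 2) / 2]. *)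
Lemma cayley_hamilton_traceless x : \tr x = 0 ->
  x *m (x *m x) = (\tr (x *m x) / 2) *: x + (\det x)%:M.
Proof.
rewrite /mxtrace sum_I3 => /(canRL (addKr _)) x22.
apply/matrixP; apply: forall_I3; apply: forall_I3;
  rewrite /mxtrace det3 !(mxE, sum_I3) /= x22; by field.
Qed.

Lemma nilpotent_of_traces c : \tr c = 0 -> \tr (c *m c) = 0 ->
  \tr (c *m (c *m c)) = 0 -> c *m (c *m c) = 0.
Proof.
move=> c1 c2; rewrite cayley_hamilton_traceless // c2 mul0r scale0r add0r.
rewrite mxtrace_scalar => /eqP; rewrite mulrn_eq0 /= => /eqP ->.
by rewrite raddf0.
Qed.

Definition jordan3 : 'M[K]_3 :=
  \matrix_(i, j) (j == i.+1 :> nat)%:R.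

(** If [c ^ 2 = 0], [[c, [c, z]] = - 2 c z c], and a generalized inverse of [c]
    does up to a factor.  Otherwise [c] is conjugate to the nilpotent Jordan
    block [J], for which [z = - J^T] works. *)
Lemma jacobson_morozov3 c : c *m (c *m c) = 0 ->
  exists2 z, z \in sl K 3 & lie c (lie c z) = c.
Proof.
move=> c3.
suff [z cz] : exists z, lie c (lie c z) = c.
  (* Removing the scalar part of z does not affect the brackets. *)
  exists (z - (\tr z / 3)%:M).
    rewrite memv_sl linearB /= mxtrace_scalar -[(_ / _) *+ _]mulr_natr.
    by rewrite divfK ?subrr ?pnatr_eq0.
  by rewrite (lieDr c z) -raddfN lie_scalar addr0.
have [c2|c2] := eqVneq (c *m c) 0.
  have cwc : c *m pinvmx c *m c = c by rewrite mulmxKpV.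
  exists (- 2^-1 *: pinvmx c).
  rewrite (lieZr _ c (pinvmx c)) (lieZr _ c (lie c _)) lie_lie c2 mul0mx sub0r.
  rewrite cwc -mulmxA c2 mulmx0 addr0 scaleNr scalerN opprK -scaler_nat.
  by rewrite scalerA mulVf ?scale1r ?pnatr_eq0.
have [v cv] : exists v : 'rV_3, v *m c *m c != 0.
  have /rowV0Pn[_ /submxP[v ->]] := c2; by rewrite mulmxA; exists v.
have vc3 : v *m c *m c *m c = 0 by rewrite -!mulmxA c3 mulmx0.
have [|d d0|a ua ac] :=
  similar_of_rows (x := c) (y := jordan3)
    (r := fun i : 'I_3 => [:: v; v *m c; v *m c *m c]`_i).
- apply: forall_I3; rewrite sum_I3 !mxE /= ?vc3;
    by rewrite ?scale0r ?scale1r ?(addr0, add0r).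
- move: d0; rewrite sum_I3 /= => d0.
  have e0 : d 0 i0 = 0.
    move/(congr1 (fun w => w *m c *m c)): d0.
    rewrite !mulmxDl -!scalemxAl vc3 mul0mx !scaler0 !addr0 !mul0mx => /eqP.
    by rewrite scaler_eq0 (negPf cv) orbF => /eqP.
  have e1 : d 0 i1 = 0.
    move/(congr1 (fun w => w *m c)): d0.
    rewrite e0 scale0r add0r mulmxDl -!scalemxAl vc3 !scaler0 !addr0 !mul0mx.
    by move/eqP; rewrite scaler_eq0 (negPf cv) orbF => /eqP.
  have e2 : d 0 i2 = 0.
    move/eqP: d0; rewrite e0 e1 !scale0r !add0r scaler_eq0 (negPf cv) orbF.
    by move/eqP.
  by apply/rowP; apply: forall_I3; rewrite mxE.
have JJ : lie jordan3 (lie jordan3 (- jordan3^T)) = jordan3.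
  apply/matrixP; apply: forall_I3; apply: forall_I3;
    rewrite /lie !(mxE, sum_I3) /=; ring.
have ua' : invmx a \in unitmx by rewrite unitmx_inv.
exists (Ad (invmx a) (- jordan3^T)).
by rewrite -[c](AdK ua) ac !lie_Ad // JJ.
Qed.

End Traceless.

(** * Reductive pairs with h of dimension two are abelian *)

Lemma memv_span2 (K : fieldType) (V : vectType K) (x y w : V) :
  w \in <<[:: x; y]>>%VS -> exists a b, w = a *: x + b *: y.
Proof.
rewrite span_cons span_seq1 => /memv_addP[_ /vlineP[a ->]].
by case=> _ /vlineP[b ->] ->; exists a, b.
Qed.

Lemma free2 (K : fieldType) (V : vectType K) (x y : V) a b :
  free [:: x; y] -> a *: x + b *: y = 0 -> a = 0 /\ b = 0.
Proof.
rewrite free_cons span_seq1 seq1_free => /andP[xy y0].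
have [->|a0] := eqVneq a 0.
  rewrite scale0r add0r => /eqP; rewrite scaler_eq0 (negPf y0) orbF.
  by move=> /eqP ->.
move=> /eqP; rewrite addr_eq0 => /eqP /(canRL (scalerK a0)) xE.
by case/negP: xy; rewrite xE memvZ // memvN memvZ // memv_line.
Qed.

Lemma dimv2_basis (K : fieldType) (V : vectType K) (U : {vspace V}) :
  \dim U = 2%N -> exists x y : V, <<[:: x; y]>>%VS = U /\ free [:: x; y].
Proof.
move=> dU; move: (vbasisP U) (size_tuple (vbasis U)).
rewrite [RHS in _ = RHS]dU.
case: (tval _) => [|x [|y []]] //= /andP[/eqP sU fU] _.
by exists x, y.
Qed.

Section Abelian.
Variables (K : numFieldType) (h m : {vspace 'M[K]_3}).
Hypothesis red : reductive_pair (sl K 3) h m.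

Lemma reductive_traceless x : x \in h -> \tr x = 0.
Proof.
by case: red => -[/subvP hg _] _ _ _ /hg; rewrite memv_sl => /eqP.
Qed.

(** Jacobson-Morozov provides the [z] required by [reductive_ad2_eq0]. *)
Lemma reductive_nilpotent_eq0 c : c \in h -> c *m (c *m c) = 0 ->
  (forall w, w \in h -> lie c (lie c w) = 0) -> c = 0.
Proof.
move=> hc /jacobson_morozov3[z zg cz]; exact: reductive_ad2_eq0 red hc zg cz.
Qed.

(** Otherwise [c = [x, y]] spans the derived algebra, so that [ad c ^ 2 = 0] on
    [h], and [[x, c]] or [[y, c]] is a nonzero multiple of [c].  Then [c] and
    its powers are, up to a factor, commutators of the form [[z, c] c ^ k],
    which are traceless: [c] is nilpotent. *)
Lemma reductive_dim2_abelian :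
  \dim h = 2%N -> forall x y, x \in h -> y \in h -> lie x y = 0.
Proof.
move=> /dimv2_basis[x [y [hxy _]]].
have [hx hy] : x \in h /\ y \in h.
  by split; rewrite -hxy memv_span // !inE eqxx ?orbT.
have lieE a b a' b' : lie (a *: x + b *: y) (a' *: x + b' *: y) =
    (a * b' - b * a') *: lie x y.
  rewrite (lieDr _ (a' *: x)) (lieDl (a *: x)) (lieDl (a *: x)).
  rewrite !(lieZr _ _ x) !(lieZr _ _ y) !(lieZl _ x) !(lieZl _ y).
  rewrite !liexx (lieC y x) !scaler0 add0r addr0 !scalerN !scalerA.
  by rewrite addrC -scalerBl [a' * b]mulrC [b' * a]mulrC.
suff c0 : lie x y = 0.
  move=> u v; rewrite -hxy => /memv_span2[a [b ->]] /memv_span2[a' [b' ->]].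
  by rewrite lieE c0 scaler0.
have hc : lie x y \in h by case: red => -[_ hh] _ _ _; apply: hh.
have [al [be cE]] : exists al be, lie x y = al *: x + be *: y.
  by apply: memv_span2; rewrite hxy.
have cw w : w \in h -> lie (lie x y) (lie (lie x y) w) = 0.
  rewrite -hxy => /memv_span2[a [b ->]].
  rewrite [X in lie _ (lie X _)]cE (lieE al) (lieZr _ _ (lie x y)).
  by rewrite (liexx (lie x y)) scaler0.
have nil z l : l != 0 -> lie z (lie x y) = l *: lie x y -> lie x y = 0.
  move=> l0 zc; have lc : lie x y = l^-1 *: lie z (lie x y).
    by rewrite zc scalerK.
  apply: reductive_nilpotent_eq0 => //; apply: nilpotent_of_traces.
  - exact: reductive_traceless.
  - by rewrite {1}lc -scalemxAl linearZ /= mxtrace_lie_mul mulr0.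
  - by rewrite {1}lc -scalemxAl linearZ /= mxtrace_lie_mul2 mulr0.
have xc : lie x (lie x y) = be *: lie x y.
  have := lieE 1 0 al be; rewrite -cE scale1r scale0r addr0 => ->.
  by rewrite mul1r mul0r subr0.
have yc : lie y (lie x y) = - al *: lie x y.
  have := lieE 0 1 al be; rewrite -cE scale1r scale0r add0r => ->.
  by rewrite mul1r mul0r sub0r.
have [be0|/nil/(_ xc)//] := eqVneq be 0.
have [al0|al0] := eqVneq al 0; first by rewrite cE al0 be0 !scale0r addr0.
by apply: nil yc; rewrite oppr_eq0.
Qed.

End Abelian.

Section Pencil.
Variables (R : rcfType) (n : nat).
Implicit Types x y : 'M[R]_n.

(** The intermediate value theorem for the polynomial [det (x + t (y - x))]. *)
Lemma det_segment_root x y : \det x * \det y <= 0 ->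
  exists t, \det ((1 - t) *: x + t *: y) = 0.
Proof.
move=> xy.
pose p : {poly R} := \det (map_mx polyC x + 'X *: map_mx polyC (y - x)).
have pE t : p.[t] = \det ((1 - t) *: x + t *: y).
  rewrite -horner_evalE -det_map_mx; congr (\det _); apply/matrixP => i j.
  rewrite !mxE /= horner_evalE !hornerE; ring.
have p0 : p.[0] = \det x by rewrite pE subr0 scale0r scale1r addr0.
have p1 : p.[1] = \det y by rewrite pE subrr scale0r scale1r add0r.
suff [t /rootP pt] : exists t, root p t by exists t; rewrite -pE.
have [x0|x0] := leP (\det x) 0; have [y0|y0] := leP (\det y) 0.
- have : \det x * \det y = 0 by apply/le_anti; rewrite xy mulr_le0.
  move/eqP; rewrite mulf_eq0 -p0 -p1 => /orP[] p00;
    [exists 0|exists 1]; exact: p00.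
- have [|t _ pt] := poly_ivt (p := p) (@ler01 R); last by exists t.
  by rewrite p0 p1 x0 ltW.
- have [|t _ pt] := poly_ivt (p := - p) (@ler01 R).
    by rewrite !hornerN p0 p1 oppr_ge0 oppr_le0 y0 ltW.
  by exists t; rewrite -rootN.
- by move: xy; rewrite leNgt mulr_gt0.
Qed.

(** For odd [n] one has [det (- y) = - det y], so the determinant changes sign
    along one of the segments from [x] to [y] and from [x] to [- y]; neither
    passes through 0 when [x] and [y] are independent. *)
Lemma exists_singular (V : {vspace 'M[R]_n}) : odd n -> \dim V = 2%N ->
  exists x, [/\ x \in V, x != 0 & \det x = 0].
Proof.
move=> nodd /dimv2_basis[x [y [hxy fxy]]].
suff [a [b [ab0 dab]]] :
    exists a b, (a, b) != (0, 0) /\ \det (a *: x + b *: y) = 0.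
  exists (a *: x + b *: y); split=> //.
    by rewrite -hxy memvD // memvZ // memv_span // !inE eqxx ?orbT.
  by apply: contraNneq ab0 => /(free2 fxy)[-> ->].
have [dxy|dxy] := leP (\det x * \det y) 0.
  have [t dt] := det_segment_root dxy; exists (1 - t), t; split=> //.
  by apply/eqP => -[]; lra.
have [|t dt] := @det_segment_root x (- y).
  by rewrite -scaleN1r detZ -signr_odd nodd expr1 mulN1r mulrN oppr_le0 ltW.
exists (1 - t), (- t); split; first by apply/eqP => -[]; lra.
by rewrite scaleNr -scalerN.
Qed.

End Pencil.

(** * Normal forms under conjugation *)

Section NormalForms.
Variable R : realType.
Implicit Types (x y a d : 'M[R]_3) (h m : {vspace 'M[R]_3}).

(** If [s = 1] or [s = -1] were not an eigenvalue, cancelling [x - s] in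
    [(x - s) (x ^ 2 + s x) = 0] would give [x ^ 2 = - s x], of trace 0.  So [x]
    has the three eigenvalues 0, -1 and 1. *)
Lemma similar_split x : x *m (x *m x) = x -> \tr x = 0 ->
    \tr (x *m x) != 0 -> \det x = 0 ->
  exists2 a, a \in unitmx & Ad a x = e R 8 - e R 5.
Proof.
move=> x3 x1 x2 /eqP/det0P[u0 u0n u0x].
have eigen s : s * s = 1 -> exists2 u : 'rV_3, u != 0 & u *m x = s *: u.
  move=> ss; have /det0P[u un us] : \det (x - s%:M) == 0.
    apply: contraNT x2 => ds.
    have us : x - s%:M \in unitmx by rewrite unitmxE unitfE.
    have : (x - s%:M) *m (x *m x + s *: x) = 0.
      rewrite mulmxBl !mulmxDr x3 -!scalemxAr !mul_scalar_mx scalerA ss scale1r.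
      by rewrite [s *: _ + x]addrC subrr.
    move/(congr1 (mulmx (invmx (x - s%:M)))); rewrite mulKmx // mulmx0.
    move/eqP; rewrite addr_eq0 => /eqP ->.
    by rewrite linearN linearZ /= x1 mulr0 oppr0.
  by exists u => //; apply/eqP; rewrite -subr_eq0 -mul_mx_scalar -mulmxBr us.
have [|u1 u1n u1x] := eigen (-1); first by ring.
have [|u2 u2n u2x] := eigen 1; first by ring.
apply: (similar_of_rows (r := fun i : 'I_3 => [:: u0; u1; u2]`_i)).
  apply: forall_I3; rewrite sum_I3 !mxE /= ?u0x ?u1x ?u2x;
    by rewrite !(subrr, oppr0, subr0, sub0r, addr0, add0r, scale0r).
move=> c; rewrite sum_I3 /= => c0.
have cx : c 0 i2 *: u2 - c 0 i1 *: u1 = 0.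
  move/(congr1 (mulmx^~ x)): c0.
  rewrite !mulmxDl -!scalemxAl u0x u1x u2x mul0mx scaler0 add0r scaleN1r.
  by rewrite scalerN scale1r addrC.
have cxx : c 0 i2 *: u2 + c 0 i1 *: u1 = 0.
  move/(congr1 (mulmx^~ x)): cx; rewrite mulmxBl -!scalemxAl u1x u2x mul0mx.
  by rewrite scaleN1r scalerN opprK scale1r.
have e2 : c 0 i2 = 0.
  have := congr2 +%R cx cxx; rewrite addrACA addNr !addr0 -scalerDl => /eqP.
  rewrite scaler_eq0 (negPf u2n) orbF -mulr2n mulrn_eq0 /= => /eqP //.
have e1 : c 0 i1 = 0.
  move/eqP: cxx; rewrite e2 scale0r add0r scaler_eq0 (negPf u1n) orbF.
  by move/eqP.
have e0 : c 0 i0 = 0.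
  move/eqP: c0; rewrite e1 e2 !scale0r !addr0 scaler_eq0 (negPf u0n) orbF.
  by move/eqP.
by apply/rowP; apply: forall_I3; rewrite mxE.
Qed.

(** On the image of [x], [x ^ 2 = - 1]: the plane spanned by [w] and [w x], for
    a nonzero [w] in the image, is rotated, and the kernel of [x] supplements
    it. *)
Lemma similar_rot x : x *m (x *m x) = - x -> x != 0 -> \det x = 0 ->
  exists2 a, a \in unitmx & Ad a x = e R 6 - e R 7.
Proof.
move=> x3 xn /eqP/det0P[u un ux].
have [w wn wxx] : exists2 w : 'rV_3, w != 0 & w *m x *m x = - w.
  have /rowV0Pn[_ /submxP[v ->] vx] := xn; exists (v *m x) => //.
  by rewrite -!mulmxA x3 mulmxN.
apply: (similar_of_rows (r := fun i : 'I_3 => [:: u; w; w *m x]`_i)).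
  apply: forall_I3; rewrite sum_I3 !mxE /= ?ux ?wxx;
    by rewrite !(subrr, oppr0, subr0, sub0r, addr0, add0r, scale0r,
      scale1r, scaleN1r).
move=> c; rewrite sum_I3 /= => c0.
have cx : c 0 i1 *: (w *m x) - c 0 i2 *: w = 0.
  move/(congr1 (mulmx^~ x)): c0.
  by rewrite !mulmxDl -!scalemxAl ux wxx mul0mx scaler0 add0r scalerN.
have cxx : c 0 i1 *: w + c 0 i2 *: (w *m x) = 0.
  move/(congr1 (mulmx^~ x)): cx; rewrite mulmxBl -!scalemxAl wxx mul0mx scalerN.
  by move/eqP; rewrite -opprD oppr_eq0 => /eqP.
have wx : w *m x != 0.
  by apply: contraNneq wn => wx; rewrite -oppr_eq0 -wxx wx mul0mx.
(* As x acts like i on the plane, this multiplies c1 + c2 i by its conjugate. *)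
have : (c 0 i1 ^+ 2 + c 0 i2 ^+ 2) *: (w *m x) = 0.
  transitivity (c 0 i1 *: (c 0 i1 *: (w *m x) - c 0 i2 *: w)
    + c 0 i2 *: (c 0 i1 *: w + c 0 i2 *: (w *m x))).
    by move: (w *m x) => v; apply/rowP => j; rewrite !mxE; ring.
  by rewrite cx cxx !scaler0 addr0.
move/eqP; rewrite scaler_eq0 (negPf wx) orbF.
rewrite paddr_eq0 ?sqr_ge0 // !sqrf_eq0 => /andP[/eqP e1 /eqP e2].
have e0 : c 0 i0 = 0.
  move/eqP: c0; rewrite e1 e2 !scale0r !addr0 scaler_eq0 (negPf un) orbF.
  by move/eqP.
by apply/rowP; apply: forall_I3; rewrite mxE.
Qed.


(** If [Ad a x] commutes with every [diag(t, 1, 1)], multiplying [a] on the left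
    by [diag(1 / det a, 1, 1)] does not change the conjugate. *)
Lemma conj_det1 x a : a \in unitmx ->
    (forall i, i != i0 -> Ad a x i0 i = 0) ->
    (forall i, i != i0 -> Ad a x i i0 = 0) ->
  exists2 b, \det b = 1 & Ad b x = Ad a x.
Proof.
move=> ua row0 col0.
pose d : 'M[R]_3 := diag_mx (\row_i (if i == i0 then (\det a)^-1 else 1)).
have a0 : \det a != 0 by rewrite -unitfE -unitmxE.
have dd : \det d = (\det a)^-1.
  by rewrite det_diag /= !big_ord_recl big_ord0 !mxE /= !mulr1.
have ud : d \in unitmx by rewrite unitmxE dd unitfE invr_eq0.
exists (d *m a); first by rewrite det_mulmx dd mulVf.
rewrite AdM //; move: (Ad a x) row0 col0 => y row0 col0.
rewrite /Ad; apply: (canLR (mulmxK ud)).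
apply/matrixP=> i j; rewrite mul_diag_mx mul_mx_diag !mxE [RHS]mulrC.
have [->|ni] := eqVneq i i0; have [->|nj] := eqVneq j i0 => //.
  by rewrite row0 // !mulr0.
by rewrite col0 // !mulr0.
Qed.

End NormalForms.

(** * The two standard pairs *)

Section Classification.
Variable R : realType.
Implicit Types (x y z a d : 'M[R]_3) (h m k : {vspace 'M[R]_3}).

Lemma mem_h26 x : x \in h26 R <->
  exists a b : R, x = sl3_mx (nth 0 [:: 0; 0; 0; 0; 0; a; 0; 0; b]).
Proof.
have E (a b : R) : sl3_mx (nth 0 [:: 0; 0; 0; 0; 0; a; 0; 0; b]) =
    a *: e R 5 + b *: e R 8 by entrywise; ring.
split=> [/memv_span2[a [b ->]]|[a [b ->]]]; first by exists a, b.
by rewrite E memvD // memvZ // memv_span // !inE eqxx ?orbT.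
Qed.

Lemma mem_h30 x : x \in h30 R <->
  exists a b : R, x = sl3_mx (nth 0 [:: 0; 0; 0; 0; 0; a; b; - b; a]).
Proof.
have E (a b : R) : sl3_mx (nth 0 [:: 0; 0; 0; 0; 0; a; b; - b; a]) =
    a *: (e R 5 + e R 8) + b *: (e R 6 - e R 7) by entrywise; ring.
split=> [/memv_span2[a [b ->]]|[a [b ->]]]; first by exists a, b.
by rewrite E memvD // memvZ // memv_span // !inE eqxx ?orbT.
Qed.

Lemma mem_m26 x : x \in m26 R <-> exists a1 a2 a3 a4 a6 a7 : R,
  x = sl3_mx (nth 0 [:: 0; a1; a2; a3; a4; 0; a6; a7; 0]).
Proof.
have E (a1 a2 a3 a4 a6 a7 : R) :
    sl3_mx (nth 0 [:: 0; a1; a2; a3; a4; 0; a6; a7; 0]) = a1 *: e R 1 +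
    (a2 *: e R 2 + (a3 *: e R 3 + (a4 *: e R 4 + (a6 *: e R 6 + a7 *: e R 7)))).
  by entrywise; ring.
split=> [|[a1 [a2 [a3 [a4 [a6 [a7 ->]]]]]]]; last first.
  by rewrite E !memvD // memvZ // memv_span // !inE eqxx ?orbT.
rewrite /m26 4!span_cons.
move=> /memv_addP[_ /vlineP[a1 ->]] [y1 + ->].
move=> /memv_addP[_ /vlineP[a2 ->]] [y2 + ->].
move=> /memv_addP[_ /vlineP[a3 ->]] [y3 + ->].
move=> /memv_addP[_ /vlineP[a4 ->]] [y4 + ->].
move=> /memv_span2[a6 [a7 ->]].
by exists a1, a2, a3, a4, a6, a7.
Qed.

Lemma mem_m30 x : x \in m30 R <-> exists a1 a2 a3 a4 a b : R,
  x = sl3_mx (nth 0 [:: 0; a1; a2; a3; a4; a; b; b; - a]).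
Proof.
have E (a1 a2 a3 a4 a b : R) :
    sl3_mx (nth 0 [:: 0; a1; a2; a3; a4; a; b; b; - a]) = a1 *: e R 1 +
    (a2 *: e R 2 + (a3 *: e R 3 + (a4 *: e R 4 +
    (a *: (e R 5 - e R 8) + b *: (e R 6 + e R 7))))).
  by entrywise; ring.
split=> [|[a1 [a2 [a3 [a4 [a [b ->]]]]]]]; last first.
  by rewrite E !memvD // memvZ // memv_span // !inE eqxx ?orbT.
rewrite /m30 4!span_cons.
move=> /memv_addP[_ /vlineP[a1 ->]] [y1 + ->].
move=> /memv_addP[_ /vlineP[a2 ->]] [y2 + ->].
move=> /memv_addP[_ /vlineP[a3 ->]] [y3 + ->].
move=> /memv_addP[_ /vlineP[a4 ->]] [y4 + ->].
move=> /memv_span2[a [b ->]].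
by exists a1, a2, a3, a4, a, b.
Qed.

Lemma memv_sl3_mx (l : nat -> R) : sl3_mx l \in sl R 3.
Proof. by rewrite memv_sl /mxtrace sum_I3 !mxE /=; apply/eqP; ring. Qed.

Lemma reductive_pair26 : reductive_pair (sl R 3) (h26 R) (m26 R).
Proof.
split.
- split=> [|x y /mem_h26[a [b ->]] /mem_h26[a' [b' ->]]].
    by apply/subvP => x /mem_h26[a [b ->]]; exact: memv_sl3_mx.
  by apply/mem_h26; exists 0, 0; entrywise; ring.
- apply/vspaceP => x; apply/memv_addP/idP.
    case=> y /mem_m26[a1 [a2 [a3 [a4 [a6 [a7 ->]]]]]].
    by case=> z /mem_h26[a [b ->]] ->; rewrite memvD // memv_sl3_mx.
  move=> /sl3_mxP[l ->].
  exists (sl3_mx (nth 0 [:: 0; l 1; l 2; l 3; l 4; 0; l 6; l 7; 0])).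
    by apply/mem_m26; do 6![eexists].
  exists (sl3_mx (nth 0 [:: 0; 0; 0; 0; 0; l 5; 0; 0; l 8])).
    by apply/mem_h26; do 2![eexists].
  by entrywise; ring.
- apply/directv_addP/eqP; rewrite -subv0; apply/subvP => x.
  rewrite memv_cap memv0 => /andP[/mem_m26[a1 [a2 [a3 [a4 [a6 [a7 ->]]]]]]].
  move=> /mem_h26[a [b /matrixP E]]; apply/eqP.
  move: (E i0 i1) (E i0 i2) (E i1 i0) (E i2 i0) (E i1 i2) (E i2 i1).
  by rewrite !mxE /= => -> -> -> -> -> ->; entrywise; ring.
move=> x y /mem_h26[a [b ->]] /mem_m26[a1 [a2 [a3 [a4 [a6 [a7 ->]]]]]].
apply/mem_m26; exists (- (2 * a + b) * a1), (- (a + 2 * b) * a2).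
exists ((2 * a + b) * a3), ((a + 2 * b) * a4), ((a - b) * a6), ((b - a) * a7).
by entrywise; ring.
Qed.

Lemma reductive_pair30 : reductive_pair (sl R 3) (h30 R) (m30 R).
Proof.
split.
- split=> [|x y /mem_h30[a [b ->]] /mem_h30[a' [b' ->]]].
    by apply/subvP => x /mem_h30[a [b ->]]; exact: memv_sl3_mx.
  by apply/mem_h30; exists 0, 0; entrywise; ring.
- apply/vspaceP => x; apply/memv_addP/idP.
    case=> y /mem_m30[a1 [a2 [a3 [a4 [a6 [a7 ->]]]]]].
    by case=> z /mem_h30[a [b ->]] ->; rewrite memvD // memv_sl3_mx.
  move=> /sl3_mxP[l ->].
  pose a := (l 5 - l 8) / 2; pose b := (l 6 + l 7) / 2.
  pose a' := (l 5 + l 8) / 2; pose b' := (l 6 - l 7) / 2.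
  exists (sl3_mx (nth 0 [:: 0; l 1; l 2; l 3; l 4; a; b; b; - a])).
    by apply/mem_m30; do 6![eexists].
  exists (sl3_mx (nth 0 [:: 0; 0; 0; 0; 0; a'; b'; - b'; a'])).
    by apply/mem_h30; do 2![eexists].
  by entrywise; rewrite /a /b /a' /b'; field.
- apply/directv_addP/eqP; rewrite -subv0; apply/subvP => x.
  rewrite memv_cap memv0 => /andP[/mem_m30[a1 [a2 [a3 [a4 [a6 [a7 ->]]]]]]].
  move=> /mem_h30[a [b /matrixP E]]; apply/eqP.
  move: (E i0 i1) (E i0 i2) (E i1 i0) (E i2 i0).
  move: (E i1 i1) (E i2 i2) (E i1 i2) (E i2 i1).
  rewrite !mxE /= => E5 E8 E6 E7 -> -> -> ->.
  have -> : a6 = 0 by lra.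
  have -> : a7 = 0 by lra.
  by entrywise; ring.
move=> x y /mem_h30[a [b ->]] /mem_m30[a1 [a2 [a3 [a4 [a6 [a7 ->]]]]]].
apply/mem_m30; exists (b * a2 - 3 * a * a1), (- b * a1 - 3 * a * a2).
exists (3 * a * a3 + b * a4), (3 * a * a4 - b * a3), (2 * b * a7).
exists (- 2 * b * a6).
by entrywise; ring.
Qed.

Lemma dim_sl3 : \dim (sl R 3) = 8%N.
Proof.
exact: (@size_basis _ _ _ _ (in_tuple [seq e R i | i <- iota 1 8]) (e_basis R)).
Qed.

Lemma dim_reductive_pair h m :
  reductive_pair (sl R 3) h m -> (\dim m + \dim h)%N = 8%N.
Proof.
by case=> _ mhg /directv_addP dmh _; rewrite -dim_sl3 -mhg dimv_disjoint_sum.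
Qed.

(** Two complements of [h] have the same dimension. *)
Lemma reductive_pair_subr_eq h m m' : reductive_pair (sl R 3) h m ->
  reductive_pair (sl R 3) h m' -> (m' <= m)%VS -> m = m'.
Proof.
move=> /dim_reductive_pair dm /dim_reductive_pair dm' sm; apply/esym/eqP.
by rewrite eqEdim sm -(leq_add2r (\dim h)) dm dm'.
Qed.

(** The spans have dimensions at most 2 and 6, and 2 + 6 is the dimension of
    their sum: counting spares proving that the generators are independent. *)
Lemma dim_reductive_span (X Y : seq 'M[R]_3) :
  reductive_pair (sl R 3) <<X>> <<Y>> -> size X = 2%N -> size Y = 6%N ->
  \dim <<X>> = 2%N.
Proof.
move=> /dim_reductive_pair dXY sX sY; apply/eqP.
have dX : (\dim <<X>> <= 2)%N by apply: leq_trans (dim_span X) _; rewrite sX.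
have dY : (\dim <<Y>> <= 6)%N by apply: leq_trans (dim_span Y) _; rewrite sY.
rewrite eqn_leq dX -(leq_add2l (\dim <<Y>>)) dXY.
by apply: (@leq_trans (6 + 2)) => //; rewrite leq_add2r.
Qed.

Lemma dim_h26 : \dim (h26 R) = 2%N.
Proof. exact: dim_reductive_span reductive_pair26 _ _. Qed.

Lemma dim_h30 : \dim (h30 R) = 2%N.
Proof. exact: dim_reductive_span reductive_pair30 _ _. Qed.

(** [e1] to [e4] are the matrix units in the first row and column off the
    corner; their brackets give all the others. *)
Lemma lie_generates_e1234 m : (m <= sl R 3)%VS ->
  (forall j, (0 < j < 5)%N -> e R j \in m) -> lie_generates (sl R 3) m.
Proof.
move=> mg em; split=> // k [kg kk] /subvP mk.
have ek j : (0 < j < 5)%N -> e R j \in k by move=> /em /mk.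
apply/eqP; rewrite eqEsubv kg /=.
have /andP[/eqP <- _] := e_basis R; apply/span_subvP => _ /mapP[j + ->].
have e5 : e R 5 = lie (e R 3) (e R 1) by entrywise; ring.
have e6 : e R 6 = lie (e R 3) (e R 2) by entrywise; ring.
have e7 : e R 7 = lie (e R 4) (e R 1) by entrywise; ring.
have e8 : e R 8 = lie (e R 4) (e R 2) by entrywise; ring.
rewrite !inE => /or4P[|||/or4P[|||/orP[]]] /eqP ->;
  by [apply: ek | rewrite (e5, e6, e7, e8); apply: kk; apply: ek].
Qed.

Lemma generates26 : lie_generates (sl R 3) (m26 R).
Proof.
apply: lie_generates_e1234 => [|j j5].
  by case: reductive_pair26 => _ <- _ _; apply: addvSl.
by apply: memv_span; case: j j5 => [|[|[|[|[]]]]] // _; rewrite !inE eqxx ?orbT.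
Qed.

Lemma generates30 : lie_generates (sl R 3) (m30 R).
Proof.
apply: lie_generates_e1234 => [|j j5].
  by case: reductive_pair30 => _ <- _ _; apply: addvSl.
by apply: memv_span; case: j j5 => [|[|[|[|[]]]]] // _; rewrite !inE eqxx ?orbT.
Qed.

(** * Classification *)

(** The bound on [m] that pins it down: [ad d] kills [h], so its image on the
    whole algebra is its image on [m]. *)
Lemma reductive_ad_sub h m d : reductive_pair (sl R 3) h m ->
  (forall w, w \in h -> lie d w = 0) -> d \in h ->
  forall z, z \in sl R 3 -> lie d z \in m.
Proof.
case=> _ <- _ hm dh hd _ /memv_addP[a ma [b hb ->]].
by rewrite (lieDr d a) (dh b) // addr0 hm.
Qed.

(** A singular nonzero element is provided by [exists_singular]; were its square
    traceless, Cayley-Hamilton would make it nilpotent. *)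
Lemma reductive_singular h m : reductive_pair (sl R 3) h m -> \dim h = 2%N ->
  exists x, [/\ x \in h, \tr x = 0, \det x = 0 &
    \tr (x *m x) = 2 \/ \tr (x *m x) = - 2].
Proof.
move=> red dh; have ab := reductive_dim2_abelian red dh.
have [//|y [hy y0 dy]] := @exists_singular R 3 h _ dh.
have ty := reductive_traceless red hy.
have t0 : \tr (y *m y) != 0.
  apply: contra_neq y0 => t0; apply: (reductive_nilpotent_eq0 red hy).
    by rewrite cayley_hamilton_traceless // t0 dy mul0r scale0r raddf0 addr0.
  by move=> w hw; rewrite (ab y w) // (ab y) // mem0v.
pose s := Num.sqrt (`|\tr (y *m y)| / 2).
have ss : s * s = `|\tr (y *m y)| / 2.
  by rewrite -expr2 sqr_sqrtr // divr_ge0.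
exists (s^-1 *: y); split.
- exact: memvZ.
- by rewrite linearZ /= ty mulr0.
- by rewrite detZ dy mulr0.
rewrite -scalemxAl -scalemxAr scalerA linearZ /= -invfM ss.
have [t1|t1] := ltP 0 (\tr (y *m y)); [left|right].
  by rewrite gtr0_norm //; field.
by rewrite ler0_norm //; field.
Qed.

Lemma lie_split (l : nat -> R) : lie (e R 8 - e R 5) (sl3_mx l) =
  sl3_mx (nth 0 [:: 0; l 1; - l 2; - l 3; l 4; 0; - 2 * l 6; 2 * l 7; 0]).
Proof. by entrywise; ring. Qed.

Lemma lie_rot (l : nat -> R) : lie (e R 6 - e R 7) (sl3_mx l) =
  sl3_mx (nth 0 [:: 0; l 2; - l 1; l 4; - l 3; l 6 + l 7; l 8 - l 5; l 8 - l 5;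
                    - (l 6 + l 7)]).
Proof. by entrywise; ring. Qed.

Lemma sl3_mx_eq0 (l : nat -> R) : sl3_mx l = 0 ->
  [/\ l 1 = 0, l 2 = 0, l 3 = 0 & l 4 = 0] /\
  [/\ l 5 = 0, l 6 = 0, l 7 = 0 & l 8 = 0].
Proof.
move=> /matrixP E; move: (E i0 i1) (E i0 i2) (E i1 i0) (E i2 i0).
by move: (E i1 i1) (E i1 i2) (E i2 i1) (E i2 i2); rewrite !mxE.
Qed.

(** The diagonal entries of [e8 - e5] are distinct: only diagonal matrices
    commute with it, and its adjoint action is invertible on [m26]. *)
Lemma reductive_eq26 h m : reductive_pair (sl R 3) h m -> \dim h = 2%N ->
  e R 8 - e R 5 \in h -> h = h26 R /\ m = m26 R.
Proof.
move=> red dh hd; have ab := reductive_dim2_abelian red dh.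
have adm := reductive_ad_sub red (fun w => ab _ w hd) hd.
have hE : h = h26 R.
  apply/eqP; rewrite eqEdim dh dim_h26 leqnn andbT; apply/subvP => x hx.
  have [[/subvP hg _] _ _ _] := red.
  have [l xE] := sl3_mxP (hg x hx).
  apply/mem_h26; exists (l 5), (l 8).
  move: (ab _ _ hd hx); rewrite xE lie_split => /sl3_mx_eq0 /=.
  move=> [[l1 /eqP l2 /eqP l3 l4] [_ /eqP l6 /eqP l7 _]].
  move: l2 l3 l6 l7; rewrite !mulf_eq0 !oppr_eq0 pnatr_eq0 /=.
  by move=> /eqP l2 /eqP l3 /eqP l6 /eqP l7; entrywise;
    rewrite ?(l1, l2, l3, l4, l6, l7).
subst h; split=> //; apply: (reductive_pair_subr_eq red reductive_pair26).
apply/subvP => _ /mem_m26[a1 [a2 [a3 [a4 [a6 [a7 ->]]]]]].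
have -> : sl3_mx (nth 0 [:: 0; a1; a2; a3; a4; 0; a6; a7; 0]) =
    lie (e R 8 - e R 5)
      (sl3_mx (nth 0 [:: 0; a1; - a2; - a3; a4; 0; - a6 / 2; a7 / 2; 0])).
  by rewrite ?lie_split ?lie_rot; entrywise; field.
by apply: adm; apply: memv_sl3_mx.
Qed.

(** The eigenvalues 0, i and -i of [e6 - e7] are distinct, so that its adjoint
    action has kernel [h30], of dimension 2, and image [m30]. *)
Lemma reductive_eq30 h m : reductive_pair (sl R 3) h m -> \dim h = 2%N ->
  e R 6 - e R 7 \in h -> h = h30 R /\ m = m30 R.
Proof.
move=> red dh hd; have ab := reductive_dim2_abelian red dh.
have adm := reductive_ad_sub red (fun w => ab _ w hd) hd.
have hE : h = h30 R.
  apply/eqP; rewrite eqEdim dh dim_h30 leqnn andbT; apply/subvP => x hx.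
  have [[/subvP hg _] _ _ _] := red.
  have [l xE] := sl3_mxP (hg x hx).
  apply/mem_h30; exists (l 5), (l 6).
  move: (ab _ _ hd hx); rewrite xE lie_rot => /sl3_mx_eq0 /=.
  move=> [[l2 /eqP l1 l4 /eqP l3] [/eqP l67 /eqP l58 _ _]].
  move: l1 l3 l67 l58; rewrite !oppr_eq0 subr_eq0 addrC addr_eq0.
  move=> /eqP l1 /eqP l3 /eqP l7 /eqP l8.
  by entrywise; rewrite ?(l1, l2, l3, l4, l7, l8).
subst h; split=> //; apply: (reductive_pair_subr_eq red reductive_pair30).
apply/subvP => _ /mem_m30[a1 [a2 [a3 [a4 [a [b ->]]]]]].
have -> : sl3_mx (nth 0 [:: 0; a1; a2; a3; a4; a; b; b; - a]) =
    lie (e R 6 - e R 7)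
      (sl3_mx (nth 0 [:: 0; - a2; a1; - a4; a3; - b / 2; a / 2; a / 2; b / 2])).
  by rewrite ?lie_split ?lie_rot; entrywise; field.
by apply: adm; apply: memv_sl3_mx.
Qed.

Lemma reductive_classification h m :
  reductive_pair (sl R 3) h m -> \dim h = 2%N ->
  SL_conjugate h m (h26 R) (m26 R) \/ SL_conjugate h m (h30 R) (m30 R).
Proof.
move=> red dh.
have [x [hx tx dx t2]] := reductive_singular red dh.
have x3 := cayley_hamilton_traceless tx; rewrite dx raddf0 addr0 in x3.
have conj (d : 'M_3) : (forall i, i != i0 -> d i0 i = 0) ->
    (forall i, i != i0 -> d i i0 = 0) ->
    (exists2 a, a \in unitmx & Ad a x = d) ->
  exists a, [/\ \det a = 1, d \in (linfun (Ad a) @: h)%VS,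
    reductive_pair (sl R 3) (linfun (Ad a) @: h) (linfun (Ad a) @: m) &
    \dim (linfun (Ad a) @: h) = 2%N].
  move=> drow dcol [a ua ax]; rewrite -ax in drow dcol.
  have [b db bx] := conj_det1 ua drow dcol.
  have ub : b \in unitmx by rewrite unitmxE db unitr1.
  exists b; split=> //; last by rewrite dim_Ad.
    by rewrite memv_Ad_img // -ax -bx AdK.
  exact: reductive_pair_Ad.
case: t2 => t2; [left|right].
  have [|||a [da hd reda dha]] := conj (e R 8 - e R 5).
  - by apply: forall_I3 => //= _; rewrite !mxE /= subrr.
  - by apply: forall_I3 => //= _; rewrite !mxE /= subrr.
  - apply: similar_split => //; first
      by rewrite x3 t2 divff ?scale1r ?pnatr_eq0.
    by rewrite t2 pnatr_eq0.
  by have [hE mE] := reductive_eq26 reda dha hd; exists a.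
have [|||a [da hd reda dha]] := conj (e R 6 - e R 7).
- by apply: forall_I3 => //= _; rewrite !mxE /= subrr.
- by apply: forall_I3 => //= _; rewrite !mxE /= subrr.
- apply: similar_rot => //.
    by rewrite x3 t2 mulNr divff ?scaleN1r ?pnatr_eq0.
  apply/eqP => x0; move/eqP: t2.
  by rewrite x0 mul0mx mxtrace0 eq_sym oppr_eq0 pnatr_eq0.
by have [hE mE] := reductive_eq30 reda dha hd; exists a.
Qed.

Lemma SL_conjugate_reductive h m h' m' :
    [/\ reductive_pair (sl R 3) h' m', \dim h' = 2%N
      & lie_generates (sl R 3) m'] ->
    SL_conjugate h m h' m' ->
  [/\ reductive_pair (sl R 3) h m, \dim h = 2%N & lie_generates (sl R 3) m].
Proof.
move=> [red dh gen] [a [da]].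
have ua : a \in unitmx by rewrite unitmxE da unitr1.
have ua' : invmx a \in unitmx by rewrite unitmx_inv.
move=> /(Ad_img_KV _ _ ua) <- /(Ad_img_KV _ _ ua) <-.
split; first exact: reductive_pair_Ad.
  by rewrite dim_Ad.
exact: lie_generates_Ad.
Qed.

(** The trace of the square, which conjugation preserves, is a sum of squares on
    the diagonal matrices of [h26] and negative at [e6 - e7] in [h30]. *)
Lemma not_conjugate_both h m m' m'' :
  SL_conjugate h m (h26 R) m' -> ~ SL_conjugate h m (h30 R) m''.
Proof.
move=> [a [da ha _]] [b [db hb _]].
have ua : a \in unitmx by rewrite unitmxE da unitr1.
have ub : b \in unitmx by rewrite unitmxE db unitr1.
have : e R 6 - e R 7 \in h30 R by apply: memv_span; rewrite !inE eqxx orbT.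
rewrite -hb memv_Ad_img //; set x := Ad _ _ => hx.
have : Ad a x \in h26 R by rewrite -ha memv_Ad_img // AdK.
move=> /mem_h26[s [t xE]].
have : \tr (Ad a x *m Ad a x) = -2.
  rewrite Ad_mul // mxtrace_Ad // -(mxtrace_Ad _ ub) -Ad_mul // AdKV //.
  by rewrite /mxtrace sum_I3 !(mxE, sum_I3) /=; ring.
rewrite xE /mxtrace sum_I3 !(mxE, sum_I3) /=; nra.
Qed.

End Classification.

Theorem proposition7 (R : realType) (h m : {vspace 'M[R]_3}) :
  ([/\ reductive_pair (sl R 3) h m, \dim h = 2%N & lie_generates (sl R 3) m]
   <-> SL_conjugate h m (h26 R) (m26 R) \/ SL_conjugate h m (h30 R) (m30 R))
  /\ ~ (SL_conjugate h m (h26 R) (m26 R) /\ SL_conjugate h m (h30 R) (m30 R)).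
Proof.
split; last by case=> c26; apply: not_conjugate_both c26.
split=> [[red dh _]|]; first exact: reductive_classification.
case; apply: SL_conjugate_reductive; split.
- exact: reductive_pair26.
- exact: dim_h26.
- exact: generates26.
- exact: reductive_pair30.
- exact: dim_h30.
- exact: generates30.
Qed.
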